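(* Let $\mathcal{A}$ be a Banach algebra such that $\mathrm{rad}(\mathcal{A})=\mathrm{rann}(\mathcal{A})$ and $\mathcal{A}/\mathrm{rad}(\mathcal{A})$ is commutative, and suppose $\mathcal{A}$ has a right identity. Let $(\delta,d)$ be a generalized derivation of $\mathcal{A}$ and $k\in\mathbb{N}$. Then: (i) if $\delta$ is $k$-skew centralizing, there exists $z\in Z(\mathcal{A})$ such that $\delta=R_z$; (ii) if $\delta$ is $k$-skew commuting, then $\delta=0$.
   Context: $\mathrm{rad}(\mathcal{A})$ is the Jacobson radical and $\mathrm{rann}(\mathcal{A})=\{c\in\mathcal{A}: ac=0\ \forall a\in\mathcal{A}\}$. A derivation is a linear map $d$ with $d(ab)=d(a)b+ad(b)$; a generalized derivation $(\delta,d)$ consists of a derivation $d$ and linear $\delta$ with $\delta(ab)=a\delta(b)+d(a)b$. $Z(\mathcal{A})$ is the center. Write $\langle a,b\rangle=ab+ba$. A map $T$ is $k$-skew centralizing (resp. $k$-skew commuting) if $\langle T(a),a^k\rangle\in Z(\mathcal{A})$ (resp. $=0$) for all $a\in\mathcal{A}$. $R_z(a)=az$. *)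

(* Defs.v *)
From mathcomp Require Import all_boot all_order all_algebra complex.
From mathcomp Require Import all_classical all_reals all_analysis.
Import numFieldNormedType.Exports.
Set Implicit Arguments. Unset Strict Implicit. Unset Printing Implicit Defensive.
Import Order.TTheory GRing.Theory Num.Theory.
Local Open Scope ring_scope.

(* A (possibly non-unital) complex Banach algebra is modelled as a complete
   normed space A over the complex numbers R[i] together with a product
   [mul] that is bilinear, associative and submultiplicative. *)
Section BanachAlg.
Variables (R : realType) (A : completeNormedModType R[i]) (mul : A -> A -> A).

Definition banach_algebra_mul : Prop :=
  (forall a b c, mul (mul a b) c = mul a (mul b c)) /\
  [/\
      (forall a b c, mul (a + b) c = mul a c + mul b c),
      (forall a b c, mul a (b + c) = mul a b + mul a c),
      (forall (k : R[i]) a b, mul (k *: a) b = k *: mul a b),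
      (forall (k : R[i]) a b, mul a (k *: b) = k *: mul a b)
    & (forall a b, `|mul a b| <= `|a| * `|b|)].

Definition quasi_invertible (x : A) : Prop :=
  exists y, x + y - mul x y = 0 /\ x + y - mul y x = 0.

Definition in_rad (a : A) : Prop := forall b, quasi_invertible (mul b a).

Definition in_rann (c : A) : Prop := forall a, mul a c = 0.

Definition in_center (z : A) : Prop := forall a, mul a z = mul z a.

Definition has_right_identity : Prop := exists e, forall a, mul a e = a.

Definition quotient_rad_commutative : Prop :=
  forall a b, in_rad (mul a b - mul b a).

Definition linear_map (f : A -> A) : Prop :=
  (forall a b, f (a + b) = f a + f b) /\ (forall (k : R[i]) a, f (k *: a) = k *: f a).

Definition derivation (d : A -> A) : Prop :=
  linear_map d /\ forall a b, d (mul a b) = mul (d a) b + mul a (d b).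

Definition generalized_derivation (delta d : A -> A) : Prop :=
  derivation d /\ linear_map delta /\
  forall a b, delta (mul a b) = mul a (delta b) + mul (d a) b.

(* a^n for n >= 1 (apow a 0 = a is a junk value, never used) *)
Fixpoint apow (a : A) (n : nat) : A :=
  match n with
  | 0 | 1 => a
  | m.+1 => mul (apow a m) a
  end.

Definition anticomm (a b : A) : A := mul a b + mul b a.

Definition k_skew_centralizing (k : nat) (T : A -> A) : Prop :=
  forall a, in_center (anticomm (T a) (apow a k)).

Definition k_skew_commuting (k : nat) (T : A -> A) : Prop :=
  forall a, anticomm (T a) (apow a k) = 0.

End BanachAlg.

(* Main.v *)
Require Import Defs.
From HB Require Import structures.
From mathcomp Require Import all_boot all_order all_algebra all_field complex.
From mathcomp Require Import all_classical all_reals all_analysis.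
From mathcomp Require Import ring lra.
Import numFieldNormedType.Exports.
Set Implicit Arguments. Unset Strict Implicit. Unset Printing Implicit Defensive.
Import Order.TTheory GRing.Theory Num.Theory.
Import ComplexField.Normc.
Local Open Scope ring_scope.

(* If [e] is the right identity, then [A = eA + rann A], where [eA] is a
   commutative semisimple Banach algebra with identity [e], so by Johnson's
   theorem [x |-> e d(x)] vanishes on [eA] and [d] maps [A] into [rann A].
   Writing [delta a = a z + d a] with [z = delta e], the centralizing condition
   at [e] makes [z] central and [d e = 0], hence [d = 0] on [eA]; at [e + n]
   with [n] in [rann A] it gives [d n = 0].

   Johnson's theorem, for a commutative semisimple Banach algebra: let [S] be
   the set of limits of [D x_n] with [x_n] tending to [0]. If [y] is in [S], a
   gliding hump along products of [y - lambda_j], with distinct [lambda_j] in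
   the spectrum of [y], shows that this spectrum is finite, so [p(y)] is
   quasinilpotent, hence zero, for some [p] with simple roots, and
   [p'(y) D y = 0] yields [D y = 0]. Then [y D x = D(y x) - D(y) x = 0] for all
   [x], so [y^2 = 0] and [y = 0]. By the closed graph theorem [D] is bounded,
   and the Kleinecke-Shirokov argument makes every [D a] quasinilpotent. *)

(** * Commutative Banach algebras *)

(* Completeness is only needed, and only stated, for geometrically dominated
   series, so that no topology on [C] is involved. *)
Record banach_norm (R : realType) (C : comAlgType R[i]) (nu : C -> R) : Prop :=
  BanachNorm {
    bnormD : forall x y, nu (x + y) <= nu x + nu y;
    bnormZ : forall k x, nu (k *: x) = normc k * nu x;
    bnormM : forall x y, nu (x * y) <= nu x * nu y;
    bnorm_eq0 : forall x, nu x = 0 -> x = 0;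
    bnorm_complete : forall x : nat -> C, (forall n, nu (x n) <= 2^-1 ^+ n) ->
      exists s, forall n, nu (s - \sum_(i < n) x i) <= 2 * 2^-1 ^+ n }.

Definition invertible (C : pzRingType) (x : C) := exists y, x * y = 1.

Lemma invertibleM (C : comPzRingType) (x y : C) :
  invertible x -> invertible y -> invertible (x * y).
Proof. by move=> [u xu] [v yv]; exists (u * v); rewrite mulrACA xu yv mulr1. Qed.

Lemma invertible_prod (C : comPzRingType) (I : eqType) (s : seq I) (F : I -> C) :
  (forall i, i \in s -> invertible (F i)) -> invertible (\prod_(i <- s) F i).
Proof.
move=> Finv; rewrite big_seq; elim/big_ind : _ => //; last exact: invertibleM.
by exists 1; rewrite mulr1.
Qed.

Lemma invertible_mull (C : comPzRingType) (x y : C) :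
  invertible (x * y) -> invertible x.
Proof. by move=> [u xyu]; exists (y * u); rewrite mulrA. Qed.

Lemma invertible_subX (C : comPzRingType) (x : C) n :
  invertible (1 - x ^+ n) -> invertible (1 - x).
Proof. by rewrite -{1}(expr1n _ n) subrXX; exact: invertible_mull. Qed.

Lemma geometric_small (R : realType) (r K e : R) : 0 <= r < 1 -> 0 < e ->
  exists n0, forall n, (n0 <= n)%N -> K * r ^+ n <= e.
Proof.
move=> /andP[r0 r1] e0; have := @cvg_geometric R `|K| r.
rewrite ger0_norm // => /(_ r1) /cvgrPdist_le /(_ _ e0) [n _ nP].
exists n => m /nP /=; rewrite sub0r normrN /geometric /=; apply: le_trans.
by rewrite normrM normr_id (ger0_norm (exprn_ge0 _ r0)) ler_wpM2r ?exprn_ge0 ?ler_norm.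
Qed.

Lemma half_exp_small (R : realType) (K e : R) : 0 < e ->
  exists n, K * 2^-1 ^+ n <= e.
Proof.
move=> e0; have [|n nP] := @geometric_small _ 2^-1 K e _ e0; last by exists n; exact: nP.
by rewrite invr_ge0 ler0n invf_lt1 ?ltr1n.
Qed.

Lemma normc_ge0 (R : rcfType) (z : R[i]) : 0 <= normc z.
Proof. by case: z => a b; exact: sqrtr_ge0. Qed.

Lemma normc_real (R : rcfType) (a : R) : normc (a%:C)%C = `|a|.
Proof. by rewrite /= expr0n addr0 sqrtr_sqr. Qed.

Lemma normcX (R : rcfType) (z : R[i]) n : normc (z ^+ n) = normc z ^+ n.
Proof. by elim: n => [|n IH]; rewrite ?normc1 // !exprS normcM IH. Qed.

Section Norm.
Context {R : realType} {C : comAlgType R[i]} {nu : C -> R}.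
Hypothesis nuP : banach_norm nu.
Implicit Types x y z : C.

Lemma bnorm0 : nu 0 = 0.
Proof. by rewrite -(scale0r 1) (bnormZ nuP) normc0 mul0r. Qed.

Lemma bnormN x : nu (- x) = nu x.
Proof. by rewrite -scaleN1r (bnormZ nuP) normcN normc1 mul1r. Qed.

Lemma bnorm_ge0 x : 0 <= nu x.
Proof. by have := bnormD nuP x (- x); rewrite subrr bnorm0 bnormN; lra. Qed.

Lemma bnormB x y : nu (x - y) <= nu x + nu y.
Proof. by rewrite -(bnormN y) (bnormD nuP). Qed.

Lemma bnormBC x y : nu (x - y) = nu (y - x).
Proof. by rewrite -bnormN opprB. Qed.

Lemma bnorm_leM x y a b : nu x <= a -> nu y <= b -> nu (x * y) <= a * b.
Proof.
by move=> xa yb; apply: le_trans (bnormM nuP _ _) _; rewrite ler_pM ?bnorm_ge0.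
Qed.

Lemma bnormX x n : (0 < n)%N -> nu (x ^+ n) <= nu x ^+ n.
Proof.
elim: n => [//|[_|n IH] _]; first by rewrite !expr1.
by rewrite !(exprS _ n.+1) bnorm_leM // IH.
Qed.

Lemma bnorm_eq0_small x K : (forall n, nu x <= K * 2^-1 ^+ n) -> x = 0.
Proof.
move=> small; apply: (bnorm_eq0 nuP); apply/eqP.
rewrite eq_le bnorm_ge0 andbT leNgt; apply/negP => nux.
have [|n] := @half_exp_small R K (nu x / 2); first lra.
by have := small n; set a := _ * _; lra.
Qed.

(** Dividing the terms by [M] reduces this to [bnorm_complete]; when [M <= 0] all terms vanish. *)
Lemma bnorm_series M (x : nat -> C) : (forall n, nu (x n) <= M * 2^-1 ^+ n) ->
  exists s, forall n, nu (s - \sum_(i < n) x i) <= 2 * M * 2^-1 ^+ n.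
Proof.
move=> xM; have [M0|M0] := leP M 0.
  have x0 n : x n = 0.
    apply: (bnorm_eq0 nuP); apply/eqP; rewrite eq_le bnorm_ge0 andbT.
    by apply: le_trans (xM n) _; rewrite mulr_le0_ge0 // exprn_ge0 ?invr_ge0.
  have M00 : M = 0 by have := bnorm_ge0 (x 0); have := xM 0; rewrite expr0; lra.
  by exists 0 => n; rewrite big1 // subrr bnorm0 M00 mulr0 mul0r.
have cM' : normc (M%:C)%C = M by rewrite normc_real gtr0_norm.
have cM : normc (M%:C)%C^-1 = M^-1 by rewrite normcV cM'.
have M0' : (M%:C)%C != 0 by apply/eqP; case; lra.
have [|s sP] := bnorm_complete nuP (x := fun n => (M%:C)%C^-1 *: x n).
  by move=> n; rewrite (bnormZ nuP) cM mulrC ler_pdivrMr // mulrC.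
exists ((M%:C)%C *: s) => n.
rewrite (_ : _ - _ = (M%:C)%C *: (s - \sum_(i < n) (M%:C)%C^-1 *: x i)); last first.
  by rewrite scalerBr -scaler_sumr scalerA divff // scale1r.
by rewrite (bnormZ nuP) cM' [2 * M]mulrC -mulrA ler_pM2l.
Qed.

(** The inverse is the Neumann series, whose ratio 1/2 is the one [bnorm_complete] handles. *)
Lemma invertible_sub1 u : nu u <= 2^-1 -> invertible (1 - u).
Proof.
(* The constant has to dominate 1 for positive exponents and [nu 1], which may exceed 1, for
   [n = 0]. *)
move=> u2; have uM n : nu (u ^+ n) <= (nu 1 + 1) * 2^-1 ^+ n.
  case: n => [|n]; first by rewrite !expr0; lra.
  apply: le_trans (bnormX _ _) _ => //.
  apply: (@le_trans _ _ (2^-1 ^+ n.+1)); first by rewrite lerXn2r ?nnegrE ?bnorm_ge0 ?invr_ge0.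
  rewrite ler_peMl ?exprn_ge0 ?invr_ge0 //; by have := bnorm_ge0 1; lra.
have [s sP] := bnorm_series uM; exists s.
apply/subr0_eq/(@bnorm_eq0_small _ (nu (1 - u) * (2 * (nu 1 + 1)) + (nu 1 + 1))) => n.
rewrite (_ : _ - 1 = (1 - u) * (s - \sum_(i < n) u ^+ i) - u ^+ n); last first.
  have := subrXX 1 u n; rewrite expr1n.
  rewrite (eq_bigr (fun i : 'I_n => u ^+ i)); last by move=> i _; rewrite expr1n mul1r.
  by move=> E; rewrite mulrBr -E; ring.
apply: le_trans (bnormB _ _) _; rewrite [leRHS]mulrDl lerD //.
by rewrite -mulrA bnorm_leM // mulrA.
Qed.

End Norm.

(** * Quasinilpotent elements *)

Lemma normc_le_ReIm (R : rcfType) (a b : R) : normc (a +i* b)%C <= `|a| + `|b|.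
Proof.
rewrite /= -(ger0_norm (addr_ge0 (normr_ge0 a) (normr_ge0 b))) -sqrtr_sqr ler_wsqrtr //.
rewrite sqrrD !real_normK ?num_real // lerD2r lerDl.
by rewrite mulrn_wge0 // mulr_ge0.
Qed.

Lemma ReIm_le_normc (R : rcfType) (a b : R) :
  `|a| <= normc (a +i* b)%C /\ `|b| <= normc (a +i* b)%C.
Proof.
by split; rewrite /= -sqrtr_sqr ler_wsqrtr // ?lerDl ?lerDr sqr_ge0.
Qed.

Lemma locally_bounded_disc (R : realType) (g : R[i] -> R) (rho : R) :
  (forall z, exists e M, 0 < e /\ forall z', normc (z' - z) < e -> g z' <= M) ->
  exists M, forall z, normc z <= rho -> g z <= M.
Proof.
move=> gloc.
have cptK : compact (`[- rho, rho] `*` `[- rho, rho])%classic.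
  by apply: compact_setX; exact: segment_compact.
(* Compactness in near-covering form, the parameter [M] tending to infinity: near each point
   [g <= M] for all large [M], hence so on the whole square, which contains the disc. *)
have /compact_near_coveringP/(_ _ (pinfty_nbhs R)
  (fun M p => g (p.1 +i* p.2)%C <= M) _) := cptK.
case.
- move=> [a b] _; have [e [M [e0 eM]]] := gloc (a +i* b)%C.
  exists (ball (a, b) (e / 2), [set x | M < x]%classic).
    split; first by apply: nbhsx_ballx; rewrite divr_gt0.
    by exists M; split; first exact: num_real.
  move=> [[a' b'] M'] /= [[/= ha hb] MM']; apply: le_trans (ltW MM').
  apply: eM => /=; apply: le_lt_trans (normc_le_ReIm _ _) _.
  move: ha hb; rewrite /ball /= => ha hb.
  by rewrite distrC [`|b' - b|]distrC; lra.
- move=> M0 [_ /(_ (M0 + 1))]; rewrite ltrDl ltr01 => /(_ isT) MP.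
  exists (M0 + 1) => -[a b] z; apply: (MP (a, b)).
  have [h1 h2] := ReIm_le_normc a b.
  by split; rewrite /= in_itv /= -ler_norml; [apply: le_trans h1 z|apply: le_trans h2 z].
Qed.

(** * Elementary resolvent estimates, in place of complex function theory *)

Section Rickart.
Variables (R : realType) (C : comAlgType R[i]) (nu : C -> R).
Hypothesis nuP : banach_norm nu.
Implicit Types (x y u v w : C) (z : R[i]).

Lemma inverse_unique x y y' : x * y = 1 -> x * y' = 1 -> y = y'.
Proof. by move=> xy xy'; rewrite -[y]mulr1 -xy' mulrA [y * x]mulrC xy mul1r. Qed.

Lemma bnorm_inverse_sub1 u v : nu u <= 2^-1 -> (1 - u) * v = 1 -> nu v <= 2 * nu 1.
Proof.
move=> u2; rewrite mulrBl mul1r => /eqP; rewrite subr_eq => /eqP vE.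
have := bnormD nuP 1 (u * v); rewrite -vE.
by have := bnorm_leM nuP u2 (lexx (nu v)); lra.
Qed.

(** Near [z] one has [1 - z' *: w = (1 - z *: w) * (1 - u)] with [u] proportional to [z' - z]; once
    [nu u <= 1/2], the inverse of [1 - u] has norm at most [2 * nu 1]. *)
Lemma resolvent_locally_bounded w (Rz : R[i] -> C) :
  (forall z, (1 - z *: w) * Rz z = 1) ->
  forall z, exists e M, 0 < e /\ forall z', normc (z' - z) < e -> nu (Rz z') <= M.
Proof.
move=> RzP z; pose K := nu (w * Rz z) + 1.
have K0 : 0 < K by have := bnorm_ge0 nuP (w * Rz z); rewrite /K; lra.
exists (K^-1 / 2), (nu (Rz z) * (2 * nu 1)); split.
  by rewrite divr_gt0 // invr_gt0.
move=> z' zz'; pose u := (z' - z) *: (w * Rz z).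
have u2 : nu u <= 2^-1.
  rewrite (bnormZ nuP); apply: (@le_trans _ _ (K^-1 / 2 * K)).
    rewrite ler_pM ?normc_ge0 ?bnorm_ge0 ?(ltW zz') //.
    by rewrite /K; lra.
  by rewrite mulrAC mulVf ?mul1r // gt_eqF.
have [v uv] := invertible_sub1 nuP u2.
rewrite (_ : Rz z' = Rz z * v); last first.
  apply: inverse_unique (RzP z') _.
  have -> : 1 - z' *: w = (1 - z *: w) * (1 - u).
    rewrite mulrBr mulr1 /u -scalerAr [w * _]mulrC mulrA RzP mul1r scalerBl.
    ring.
  by rewrite mulrACA RzP uv mulr1.
by rewrite (bnorm_leM nuP) // (bnorm_inverse_sub1 u2 uv).
Qed.

Section Disc.
Variables (w : C) (Rz : R[i] -> C) (rho M : R).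
Hypothesis RzP : forall z, (1 - z *: w) * Rz z = 1.
Hypothesis rho_gt0 : 0 < rho.
Hypothesis RzM : forall z, normc z <= rho -> nu (Rz z) <= M.

(** Lipschitz constant of the resolvent along the radii of the disc. *)
Let L := rho * nu w * M * M.

(* [1 / (1 - u^(2n))] is the mean of [1 / (1 - u^n)] and [1 / (1 - (zeta u)^n)],
   where [zeta^n = -1], so bounds on the resolvent pass to all dyadic powers. *)
Lemma dyadic_resolvent k : exists Rk : R[i] -> C, forall z, normc z <= rho ->
  [/\ (1 - (z *: w) ^+ (2 ^ k)) * Rk z = 1, nu (Rk z) <= M
    & forall t : R, 0 <= t <= 1 -> nu (Rk z - Rk ((t%:C)%C * z)) <= L * (1 - t)].
Proof.
elim: k => [|k [Rk RkP]].
  exists Rz => z zrho; split; [by rewrite expr1|exact: RzM|].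
  move=> t /andP[t0 t1].
  have tzrho : normc ((t%:C)%C * z) <= rho.
    rewrite normcM normc_real ger0_norm //.
    by apply: le_trans zrho; rewrite ler_piMl ?normc_ge0.
  (* The resolvent identity. *)
  have -> : Rz z - Rz ((t%:C)%C * z) =
     ((1 - t)%:C%C * z) *: w * Rz z * Rz ((t%:C)%C * z).
    have -> : ((1 - t)%:C%C * z) *: w = z *: w - ((t%:C)%C * z) *: w.
      by rewrite -scalerBl rmorphB mulrBl mul1r.
    transitivity ((1 - ((t%:C)%C * z) *: w) * Rz ((t%:C)%C * z) * Rz z
      - (1 - z *: w) * Rz z * Rz ((t%:C)%C * z)); first by rewrite !RzP !mul1r.
    by ring.
  have -> : L * (1 - t) = ((1 - t) * rho * nu w) * M * M by rewrite /L; ring.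
  apply: (bnorm_leM nuP); last exact: RzM.
  apply: (bnorm_leM nuP); last exact: RzM.
  rewrite (bnormZ nuP) normcM normc_real ger0_norm ?subr_ge0 //.
  by rewrite ler_wpM2r ?bnorm_ge0 // ler_wpM2l // subr_ge0.
have [zeta zetaP] : exists zeta : R[i], zeta ^+ (2 ^ k) = -1.
  by exists ((2 ^ k).-root (-1)); rewrite rootCK // expn_gt0.
have zeta1 : normc zeta = 1.
  apply/eqP; rewrite -(@pexpr_eq1 _ _ (2 ^ k)%N) ?expn_gt0 ?normc_ge0 //.
  by rewrite -normcX zetaP normcN normc1.
exists (fun z => (2^-1%:C)%C *: (Rk z + Rk (zeta * z))) => z zrho.
have zzrho : normc (zeta * z) <= rho by rewrite normcM zeta1 mul1r.
have [R1 R2 R3] := RkP _ zrho; have [R1' R2' R3'] := RkP _ zzrho.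
have half x : (2^-1%:C)%C *: (x + x) = x :> C.
  rewrite scalerDr -scalerDl -rmorphD (_ : 2^-1 + 2^-1 = 1 :> R); last by lra.
  by rewrite rmorph1 scale1r.
split.
- rewrite -scalerAr -[RHS]half; congr (_ *: _).
  rewrite -scalerA exprZn zetaP scaleN1r opprK in R1'.
  rewrite expnSr exprM; move: R1 R1'.
  set u := _ ^+ _; set a := Rk z; set b := Rk _ => ua ub.
  transitivity ((1 + u) * ((1 - u) * a) + (1 - u) * ((1 + u) * b)); first by ring.
  rewrite ua ub; ring.
- rewrite (bnormZ nuP) normc_real ger0_norm ?invr_ge0 //.
  by have := bnormD nuP (Rk z) (Rk (zeta * z)); lra.
- move=> t t01; rewrite -scalerBr (bnormZ nuP) normc_real ger0_norm ?invr_ge0 //.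
  rewrite mulrCA opprD addrACA.
  have := bnormD nuP (Rk z - Rk ((t%:C)%C * z))
    (Rk (zeta * z) - Rk ((t%:C)%C * (zeta * z))).
  by have := R3 _ t01; have := R3' _ t01; lra.
Qed.

(** This expresses that [s] times the spectral radius of [w] is less than 1, through the dyadic
    powers that [dyadic_resolvent] controls. *)
Let evsmall (s : R) := exists k0, forall k, (k0 <= k)%N ->
  nu (((s%:C)%C *: w) ^+ (2 ^ k)) <= 2^-1.

Lemma resolvent_bound_ge0 : 0 <= M.
Proof. by apply: le_trans (bnorm_ge0 nuP _) (@RzM 0 _); rewrite normc0 ltW. Qed.

(* [1 / (1 - u^n)] is close to [1] exactly when [u^n] is small, so by the
   Lipschitz bound smallness propagates from radius [r s] to radius [s]. *)
Lemma evsmall_step r s : 0 <= r < 1 -> L * (1 - r ^+ 2) <= 8^-1 -> 0 <= s <= rho ->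
  evsmall (r * s) -> evsmall s.
Proof.
move=> /andP[r0 r1] Lr /andP[s0 srho] [k0 k0P].
have r01 : 0 <= r < 1 by rewrite r0.
have [|n nP] := @geometric_small _ r (2^-1 * M) 8^-1 r01 _.
  by rewrite invr_gt0.
exists (maxn k0 n) => k; rewrite geq_max => /andP[/k0P kk0 nk].
have [Rk RkP] := dyadic_resolvent k.
have srho' : normc (s%:C)%C <= rho by rewrite normc_real ger0_norm.
have r2 : 0 <= r ^+ 2 <= 1 by rewrite exprn_ge0 // exprn_ile1 // ltW.
have rsrho' : normc ((r ^+ 2)%:C * s%:C)%C <= rho.
  rewrite normcM !normc_real !ger0_norm ?exprn_ge0 //; apply: le_trans srho.
  by case/andP: r2 => ? ?; rewrite ler_piMl.
have [b1 bM bR] := RkP _ srho'; have [a1 aM _] := RkP _ rsrho'.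
have {}bR := bR _ r2; move: b1 a1 bM aM bR kk0.
set b := Rk _; set a := Rk _; set u := _ ^+ _; set v := _ ^+ _ => b1 a1 bM aM bR kk0.
(* [v] belongs to the radius [r ^+ 2 * s]. One factor [r] leads to the radius [r * s], where the
   powers are at most 1/2; the other contributes [r ^+ (2 ^ k)], which beats [M]. *)
have vM : nu v * M <= 8^-1.
  apply: le_trans (nP (2 ^ k)%N _); last by apply: leq_trans nk (ltnW (ltn_expl _ _)).
  rewrite mulrAC ler_wpM2r ?resolvent_bound_ge0 //.
  have -> : v = ((r%:C)%C *: ((r * s)%:C%C *: w)) ^+ (2 ^ k).
    by rewrite /v scalerA; congr ((_ *: _) ^+ _); rewrite -!rmorphM; congr (_%:C)%C; ring.
  rewrite exprZn (bnormZ nuP) normcX normc_real ger0_norm // mulrC.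
  by rewrite ler_wpM2r ?exprn_ge0.
have a1' : nu (a - 1) <= 8^-1.
  have -> : a - 1 = v * a by rewrite -a1; ring.
  exact: le_trans (bnorm_leM nuP (lexx _) aM) vM.
have b1' : nu (b - 1) <= 4^-1.
  have -> : b - 1 = (b - a) + (a - 1) by ring.
  by apply: le_trans (bnormD nuP _ _) _; lra.
(* Since [nu (b - 1) <= 1/4], this identity gives [nu u <= 1/4 + nu u / 4], so [nu u <= 1/3]. *)
have uE : u = (b - 1) - u * (b - 1).
  transitivity (u + (((1 - u) * b) - 1)); first by rewrite b1 subrr addr0.
  by ring.
have := bnormB nuP (b - 1) (u * (b - 1)); rewrite -uE.
by have := bnorm_leM nuP (lexx (nu u)) b1'; lra.
Qed.

(** Smallness is clear at the tiny radius [(1 - e) ^+ J * rho], and [J] steps of ratio [1 - e] carry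
    it out to [rho]. *)
Lemma evsmall_radius : evsmall rho.
Proof.
have L0 : 0 <= L by rewrite !mulr_ge0 ?resolvent_bound_ge0 ?(ltW rho_gt0) // (bnorm_ge0 nuP).
(* Chosen so that [L * (1 - (1 - e) ^+ 2) <= 2 * e * L <= 1/8]. *)
pose e := (16 * (L + 1))^-1.
have eL : e * (L + 1) = 16^-1 by rewrite /e invfM -mulrA mulVf ?mulr1 // gt_eqF //; lra.
have e0 : 0 < e by rewrite invr_gt0; lra.
have e1 : e <= 1 by nra.
have r01 : 0 <= 1 - e < 1 by lra.
have Lr : L * (1 - (1 - e) ^+ 2) <= 8^-1 by nra.
have [|J JP] := @geometric_small _ (1 - e) (rho * nu w) 2^-1 r01 _.
  by rewrite invr_gt0.
have : evsmall ((1 - e) ^+ J * rho).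
  exists 0 => k _; apply: le_trans (bnormX nuP _ _) _; first by rewrite expn_gt0.
  have le2 : nu ((((1 - e) ^+ J * rho)%:C)%C *: w) <= 2^-1.
    rewrite (bnormZ nuP) normc_real ger0_norm ?mulr_ge0 ?exprn_ge0 ?(ltW rho_gt0) //; last lra.
    by have := JP J (leqnn _); rewrite mulrC mulrA.
  apply: (@le_trans _ _ (2^-1 ^+ (2 ^ k))).
    by rewrite lerXn2r ?nnegrE ?(bnorm_ge0 nuP) ?invr_ge0.
  by rewrite -[leRHS]expr1 ler_wiXn2l ?invr_ge0 ?invf_le1 ?ler1n ?expn_gt0.
elim: {JP} J => [|J IH]; first by rewrite expr0 mul1r.
rewrite exprS -mulrA => /(evsmall_step r01 Lr) IH'; apply/IH/IH'.
case/andP: r01 => r0 r1.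
rewrite mulr_ge0 ?exprn_ge0 ?(ltW rho_gt0) //= ler_piMl ?(ltW rho_gt0) //.
by rewrite exprn_ile1 // ltW.
Qed.
End Disc.

(** With [rho > nu y], write [y * w] as the product of [y / rho], of norm at most 1, and [rho *: w],
    which has a small dyadic power. Then [1 - (y * w) ^+ (2 ^ k)] is invertible, and [1 - y * w]
    divides it. *)
Lemma entire_resolvent_radical w : (forall z, invertible (1 - z *: w)) ->
  forall y, invertible (1 - y * w).
Proof.
move=> /choice[Rz RzP] y; pose rho := nu y + 1.
have y0 := bnorm_ge0 nuP y.
have rho_gt0 : 0 < rho by rewrite /rho; lra.
have [M RzM] := locally_bounded_disc rho (resolvent_locally_bounded RzP).
have [k /(_ k (leqnn k)) kP] := evsmall_radius RzP rho_gt0 RzM.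
apply: (@invertible_subX _ _ (2 ^ k)); apply: (invertible_sub1 nuP).
have -> : y * w = ((rho^-1)%:C%C *: y) * ((rho%:C)%C *: w).
  rewrite -scalerAl -scalerAr scalerA -rmorphM mulVf ?gt_eqF //.
  by rewrite rmorph1 scale1r.
rewrite exprMn; apply: le_trans (bnorm_leM nuP (lexx _) kP) _.
rewrite ler_piMl ?invr_ge0 //; apply: le_trans (bnormX nuP _ _) _; first by rewrite expn_gt0.
rewrite exprn_ile1 ?(bnorm_ge0 nuP) // (bnormZ nuP) normc_real.
rewrite ger0_norm ?invr_ge0 ?(ltW rho_gt0) // mulrC ler_pdivrMr // mul1r /rho; lra.
Qed.

End Rickart.

(** * The separating space of a derivation *)

Section Separating.
Variables (R : realType) (C : comAlgType R[i]) (nu : C -> R).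
Hypothesis nuP : banach_norm nu.
Variable D : {linear C -> C}.
Hypothesis DM : forall x y, D (x * y) = D x * y + x * D y.
Implicit Types (x y z u v w b : C).

Definition separating y := forall e : R, 0 < e ->
  exists x, nu x <= e /\ nu (D x - y) <= e.

(** The quotient seminorm of [x] modulo the ideal [a C] is at least [c], expressed without forming
    the quotient. *)
Definition far a x (c : R) := forall b, c <= nu (x - a * b).

(** If [1 - a * b] had norm below 1/2, then [a * b], and with it [a], would be invertible. *)
Lemma far1 a : ~ invertible a -> far a 1 2^-1.
Proof.
move=> aN b; rewrite leNgt; apply/negP => /ltW /(invertible_sub1 nuP).
by rewrite opprB addrCA subrr addr0 => /invertible_mull.
Qed.

Lemma farD a x z c : far a x c -> far a (x + z) (c - nu z).
Proof.
move=> xf b; rewrite lerBlDr; apply: le_trans (xf b) _.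
by rewrite (_ : x - a * b = (x + z - a * b) - z) ?bnormN ?bnormB //; ring.
Qed.

Lemma farMl a x b c : far a x c -> far a (x + a * b) c.
Proof. by move=> xf b'; have := xf (b' - b); rewrite mulrBr opprB addrA. Qed.

Lemma farZ a x (k : R[i]) c : far a x c -> far a (k *: x) (normc k * c).
Proof.
move=> xf b; have [->|k0] := eqVneq k 0; first by rewrite normc0 mul0r bnorm_ge0.
rewrite (_ : _ - _ = k *: (x - a * (k^-1 *: b))).
  by rewrite (bnormZ nuP) ler_wpM2l ?normc_ge0.
by rewrite -scalerAr scalerBr scalerA divff // scale1r.
Qed.

Lemma far_weaken a x c c' : c' <= c -> far a x c -> far a x c'.
Proof. by move=> cc xf b; apply: le_trans (xf b). Qed.

(** * The gliding hump argument *)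

Section GlidingHump.
Variables (y : C) (lam : nat -> R[i]).
Hypothesis ysep : separating y.
Hypothesis lam_inj : injective lam.
Hypothesis lam_neq0 : forall n, lam n != 0.
Let a n := y - lam n *: 1.
Hypothesis lam_spec : forall n, ~ invertible (a n).

Let P i m := \prod_(i <= j < m) a j.

(** Modulo [a n] each factor [a j] is the scalar [lam n - lam j], nonzero for [j < n]. *)
Lemma hump_prod_mod m n : (m <= n)%N -> exists k q, k != 0 /\ P 0 m = k *: 1 + a n * q.
Proof.
elim: m => [|m IH] mn.
  by exists 1, 0; rewrite /P big_geq // mulr0 addr0 scale1r oner_neq0.
have [k [q [k0 PE]]] := IH (ltnW mn).
exists (k * (lam n - lam m)), ((lam n - lam m) *: 1 * q + P 0 m); split.
  rewrite mulf_neq0 // subr_eq0; apply: contraTneq mn => /lam_inj ->.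
  by rewrite ltnn.
rewrite {1}/P big_nat_recr //= -/(P 0 m).
have -> : (k * (lam n - lam m)) *: 1 = (k *: 1) * ((lam n - lam m) *: 1) :> C.
  by rewrite -scalerAl mul1r scalerA.
have -> : a m = (lam n - lam m) *: 1 + a n by rewrite /a scalerBl; ring.
by rewrite PE; ring.
Qed.

(* Modulo [a m], the product [P 0 m] and [y] are nonzero scalars. *)
Lemma hump_step m z e c : 0 < e ->
  exists x, nu x <= e /\ far (a m) (z + D (P 0 m * x)) c.
Proof.
move=> e0; have [k [q [k0 PE]]] := hump_prod_mod (leqnn m).
pose B := normc (k * lam m).
have B0 : 0 < B.
  rewrite lt_neqAle normc_ge0 andbT eq_sym; apply/eqP => /eq0_normc /eqP.
  by rewrite mulf_eq0 (negPf k0) (negPf (lam_neq0 m)).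
pose s := nu (P 0 m) + nu (D (P 0 m)) + 1.
have nP0 := bnorm_ge0 nuP (P 0 m); have nDP0 := bnorm_ge0 nuP (D (P 0 m)).
have s0 : 0 < s by rewrite /s; lra.
pose eta := B / 4 / s.
have eta0 : 0 < eta by rewrite !divr_gt0.
have etas : eta * s = B / 4 by rewrite /eta mulfVK // gt_eqF.
pose K := (`|c| + nu z + 1) / (B / 4).
have K1 : K * (B / 4) = `|c| + nu z + 1 by rewrite /K mulfVK // gt_eqF // divr_gt0.
have K0 : 0 < K.
  rewrite /K divr_gt0 ?divr_gt0 //; have := bnorm_ge0 nuP z; have := normr_ge0 c; lra.
have [|v [v1 v2]] := ysep (e := Num.min eta (e / K)).
  by rewrite lt_min eta0 divr_gt0.
move: v1 v2; rewrite !le_min => /andP[v1 v3] /andP[v2 _].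
exists ((K%:C)%C *: v); split.
  by rewrite (bnormZ nuP) normc_real gtr0_norm // mulrC -ler_pdivlMr.
rewrite -scalerAr linearZ /= addrC.
(* [r] is the error in replacing [D (P 0 m * v)] by [P 0 m * y]. The scalar part is at distance at
   least [B / 2] by [far1], so an error of at most [B / 4] leaves [B / 4], which the factor [K]
   raises above [c + nu z]. *)
pose r := P 0 m * (D v - y) + D (P 0 m) * v.
have rE : D (P 0 m * v) = (k * lam m) *: 1 + a m * (k *: 1 + q * y) + r.
  rewrite DM /r mulrBr.
  have -> : P 0 m * y = (k * lam m) *: 1 + a m * (k *: 1 + q * y).
    have -> : (k * lam m) *: 1 = (k *: 1) * (lam m *: 1) :> C.
      by rewrite -scalerAl mul1r scalerA.
    by rewrite PE /a; ring.
  by ring.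
have rs : nu r <= B / 4.
  apply: le_trans (bnormD nuP _ _) _.
  have h1 := bnorm_leM nuP (lexx (nu (P 0 m))) v2.
  have h2 := bnorm_leM nuP (lexx (nu (D (P 0 m)))) v1.
  by move: etas; rewrite /s; nra.
have h : far (a m) (D (P 0 m * v)) (B / 4).
  rewrite rE; apply: far_weaken (farD _ (farMl _ (farZ _ (far1 (lam_spec (n:=m)))))).
  by rewrite -/B; lra.
apply: far_weaken (farD _ (farZ _ h)).
rewrite normc_real gtr0_norm // K1; have := ler_norm c; lra.
Qed.

(** Adding 1 makes every factor at least 1, so [E m] dominates the norms of all tail products
    [P i m] at once. *)
Let E m := \prod_(0 <= j < m) (nu (a j) + 1).

Lemma hump_weight_gt0 m : 0 < E m.
Proof. by apply: prodr_gt0 => j _; rewrite ltr_wpDl ?bnorm_ge0. Qed.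

Lemma bnorm_hump_tail i m x : (i <= m)%N -> nu (P i m * x) <= E m * nu x.
Proof.
move=> im; have nx := bnorm_ge0 nuP x.
apply: (@le_trans _ _ (\prod_(i <= j < m) (nu (a j) + 1) * nu x)).
  rewrite /P; elim: (index_iota i m) => [|j l IH]; first by rewrite !big_nil !mul1r.
  rewrite !big_cons -!mulrA; apply: (bnorm_leM nuP) => //; lra.
rewrite ler_wpM2r // /E (big_cat_nat (leq0n i) im) /= ler_peMl //.
  by apply: prodr_ge0 => j _; rewrite addr_ge0 ?bnorm_ge0.
elim: (index_iota 0 i) => [|j l IH]; rewrite ?big_nil // big_cons.
by rewrite mulr_ege1 // lerDr bnorm_ge0.
Qed.

(** Each [x m] pushes [D] of the next partial sum far from the ideal of [a m]. All later terms
    contain the factor [a m], so they can undo this only by a bounded amount. *)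
Lemma separating_not_infinite_spectrum : False.
Proof.
(* The second summand compensates for [D (a m) * w] below, where [w = P 0 m * T m.+1] and
   [nu (T m.+1) <= 2]. *)
pose c m : R := m%:R + 2 * (nu (D (a m)) * nu (P 0 m)).
have /choice[X XP] : forall mz : nat * C, exists x, nu x <= 2^-1 ^+ mz.1 / E mz.1 /\
    far (a mz.1) (mz.2 + D (P 0 mz.1 * x)) (c mz.1).
  by move=> [m z]; apply: hump_step; rewrite divr_gt0 ?hump_weight_gt0 // exprn_gt0 ?invr_gt0.
pose z := fix z m := if m is m.+1 then z m + P 0 m * X (m, D (z m)) else 0.
pose x m := X (m, D (z m)).
have xs m : nu (x m) <= 2^-1 ^+ m / E m by have [] := XP (m, D (z m)).
have xf m : far (a m) (D (z m) + D (P 0 m * x m)) (c m).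
  by have [] := XP (m, D (z m)).
have zE m : z m = \sum_(j < m) P 0 j * x j.
  by elim: m => [|m IH]; [rewrite big_ord0|rewrite big_ord_recr /= -IH].
have tail i m : (i <= m)%N -> nu (P i m * x m) <= 2^-1 ^+ m.
  move=> im; apply: le_trans (bnorm_hump_tail _ im) _.
  by rewrite mulrC -ler_pdivlMr ?hump_weight_gt0.
(* [T i] is the sum of [P i j * x j] over [j >= i], so that [T 0 = z i + P 0 i * T i]. *)
have /choice[T TP] : forall i, exists T, forall n,
    nu (T - \sum_(j < n) P i (i + j)%N * x (i + j)%N) <= 2 * 2^-1 ^+ n.
  move=> i; apply: (bnorm_complete nuP (x := fun j => P i (i + j)%N * x (i + j)%N)) => n.
  apply: le_trans (tail _ _ (leq_addr _ _)) _.
  by rewrite exprD ler_piMl ?exprn_ge0 ?invr_ge0 // exprn_ile1 ?invr_ge0 ?invf_le1 ?ler1n.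
have TE i : T 0 = z i + P 0 i * T i.
  apply/subr0_eq/(bnorm_eq0_small nuP (K := 2 + nu (P 0 i) * 2)) => n.
  have split : \sum_(j < (i + n)%N) P 0 (0 + j)%N * x (0 + j)%N =
      z i + P 0 i * \sum_(j < n) P i (i + j)%N * x (i + j)%N.
    rewrite big_split_ord /= zE mulr_sumr; congr (_ + _); apply: eq_bigr => j _ //=.
    by rewrite mulrA -big_cat_nat //= leq_addr.
  rewrite (_ : _ - _ = (T 0 - \sum_(j < (i + n)%N) P 0 (0 + j)%N * x (0 + j)%N)
     - P 0 i * (T i - \sum_(j < n) P i (i + j)%N * x (i + j)%N)); last first.
    by rewrite split; ring.
  apply: le_trans (bnormB nuP _ _) _; rewrite [leRHS]mulrDl lerD //.
    apply: le_trans (TP _ _) _; rewrite exprD ler_pM2l // ler_piMl ?exprn_ge0 ?invr_ge0 //.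
    by rewrite exprn_ile1 ?invr_ge0 ?invf_le1 ?ler1n.
  by rewrite -mulrA (bnorm_leM nuP).
have big m : m%:R <= nu (D (T 0)).
  have T2 : nu (T m.+1) <= 2.
    by have := TP m.+1 0; rewrite big_ord0 subr0 expr0 mulr1.
  pose w := P 0 m * T m.+1.
  have -> : D (T 0) = D (z m) + D (P 0 m * x m) + a m * D w + D (a m) * w.
    rewrite (TE m.+1) /= {2}/P big_nat_recr //= -/(P 0 m) -/(x m).
    have -> : P 0 m * a m * T m.+1 = a m * w by rewrite /w; ring.
    by rewrite raddfD raddfD /= (DM (a m)); ring.
  have := farD (D (a m) * w) (farMl (D w) (xf m)).
  move=> /(_ 0); rewrite mulr0 subr0; apply: le_trans.
  have := bnorm_leM nuP (lexx (nu (D (a m)))) (bnorm_leM nuP (lexx (nu (P 0 m))) T2).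
  by rewrite -/w /c; lra.
have := archi_boundP (bnorm_ge0 nuP (D (T 0))).
by rewrite ltNge big.
Qed.

End GlidingHump.

End Separating.

(** * Johnson's theorem *)

Section ClosedGraph.
Variables (R : realType) (C : comAlgType R[i]) (nu : C -> R).
Hypothesis nuP : banach_norm nu.
Variable D : {linear C -> C}.
Hypothesis sep0 : forall y, separating nu D y -> y = 0.
Implicit Types (x y z u v w : C).

(* Baire: otherwise nested balls would produce [s] with [nu (D s) > n] for all [n]. *)
Lemma dense_sublevel : exists x0 (r K : R), 0 < r /\ forall x, nu (x - x0) <= r ->
  forall e, 0 < e -> exists x', nu (x - x') <= e /\ nu (D x') <= K.
Proof.
apply: contrapT => nodense.
(* When density fails, every ball contains, with centre within half its radius, a point around which
   [nu (D x')] exceeds [n]; [(0, 0)] is a default for nonpositive radii. *)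
have /choice[F FP] : forall nxr : nat * (C * R), exists xe : C * R,
    0 < nxr.2.2 -> [/\ 0 < xe.2, nu (xe.1 - nxr.2.1) <= nxr.2.2 / 2
      & forall x', nu (xe.1 - x') <= xe.2 -> nxr.1%:R < nu (D x')].
  move=> [n [x r]] /=; have [r0|] := ltP 0 r; last by exists (0, 0).
  apply: contrapT => noF; apply: nodense; exists x, (r / 2), n%:R.
  split; first by rewrite divr_gt0.
  move=> x1 x1r e e0; apply: contrapT => nox'; apply: noF; exists (x1, e) => _.
  split => // x' x'e /=; rewrite ltNge; apply/negP => Dx'; apply: nox'.
  by exists x'.
(* The new radius is at most half the one given by [F]; the other half absorbs the distance from the
   limit [s] to a late centre. *)
pose S := fix S n : C * R := if n is m.+1 then
  ((F (m, S m)).1, Num.min (F (m, S m)).2 (S m).2 / 2) else (0, 1).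
have S0 n : 0 < (S n).2.
  elim: n => [|n IH] /=; first exact: ltr01.
  by have [? _ _] := FP (n, S n) IH; rewrite divr_gt0 // lt_min IH andbT.
have Sr n : (S n.+1).2 <= (S n).2 / 2.
  by rewrite /= ler_pM2r ?invr_gt0 // ge_min lexx orbT.
have Sx n : nu ((S n.+1).1 - (S n).1) <= (S n).2 / 2.
  by have [_ ? _] := FP (n, S n) (S0 n).
have Sdist n k : nu ((S (n + k)%N).1 - (S n).1) <= (S n).2 - (S (n + k)%N).2.
  elim: k => [|k IH]; first by rewrite addn0 !subrr bnorm0.
  rewrite (_ : _ - _ = ((S (n + k.+1)%N).1 - (S (n + k)%N).1) + ((S (n + k)%N).1 - (S n).1)); last by ring.
  apply: le_trans (bnormD nuP _ _) _; rewrite addnS.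
  have h1 := Sr (n + k)%N; have h2 := Sx (n + k)%N; lra.
have Sh n : (S n).2 <= 2^-1 ^+ n.
  elim: n => [|n IH]; first by rewrite expr0.
  by apply: le_trans (Sr n) _; rewrite exprSr ler_pM2r ?invr_gt0.
have [n|s sP] := bnorm_complete nuP (x := fun n => (S n.+1).1 - (S n).1).
  by apply: le_trans (Sx n) _; have := Sh n; have := S0 n; lra.
have sS n : nu (s - (S n).1) <= 2 * 2^-1 ^+ n.
  have := sP n; rewrite -(big_mkord xpredT (fun i => (S i.+1).1 - (S i).1)).
  by rewrite telescope_sumr // subr0.
have Ds n : n%:R < nu (D s).
  have [e0 _ H] := FP (n, S n) (S0 n); apply: H => /=.
  have [k kP] := @half_exp_small R 2 ((F (n, S n)).2 / 2) (divr_gt0 e0 (ltr0n _ 2)).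
  rewrite bnormBC // -/(S n.+1).
  rewrite (_ : _ - _ = (s - (S (n.+1 + k)%N).1) + ((S (n.+1 + k)%N).1 - (S n.+1).1)); last by ring.
  apply: le_trans (bnormD nuP _ _) _.
  have h1 := sS (n.+1 + k)%N; have h2 := Sdist n.+1 k; have h3 := S0 (n.+1 + k)%N.
  have h4 : (S n.+1).2 <= (F (n, S n)).2 / 2 by rewrite /= ler_pM2r ?invr_gt0 // ge_min lexx.
  have h5 : 2 * 2^-1 ^+ (n.+1 + k) <= 2 * 2^-1 ^+ k :> R.
    by rewrite ler_pM2l // exprD ler_piMl ?exprn_ge0 ?invr_ge0 // exprn_ile1 ?invr_ge0 ?invf_le1 ?ler1n.
  lra.
by have := archi_boundP (bnorm_ge0 nuP (D s)); rewrite ltNge (ltW (Ds _)).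
Qed.

(** Differences of approximants of [x0 + c x] and of [x0], divided by [c = r / nu x], approximate
    [x]. *)
Lemma approx_bounded : exists K : R, 0 <= K /\ forall x e, 0 < e ->
  exists x', nu (x - x') <= e /\ nu (D x') <= K * nu x.
Proof.
have [x0 [r [K [r0 rK]]]] := dense_sublevel.
have K0 : 0 <= K.
  have [||x' [_]] := rK x0 _ 1; rewrite ?subrr ?(bnorm0 nuP) ?(ltW r0) //.
  by apply: le_trans; exact: bnorm_ge0.
exists (2 * K / r); split; first by rewrite divr_ge0 ?mulr_ge0 // ltW.
move=> x e e0; have [x00|/eqP nx0] := eqVneq (nu x) 0.
  exists 0; rewrite (bnorm_eq0 nuP x00) subrr linear0 bnorm0 // mulr0.
  by rewrite ltW.
have nx : 0 < nu x by rewrite lt_neqAle (bnorm_ge0 nuP) andbT eq_sym; apply/eqP.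
pose c := r / nu x; have c0 : 0 < c by rewrite divr_gt0.
have ce : 0 < c * e / 2 by rewrite divr_gt0 // mulr_gt0.
have [|x1 [x11 x12]] := rK (x0 + (c%:C)%C *: x) _ _ ce.
  rewrite addrAC subrr add0r (bnormZ nuP) normc_real gtr0_norm // /c.
  by rewrite mulfVK // gt_eqF.
have [|x2 [x21 x22]] := rK x0 _ _ ce.
  by rewrite subrr (bnorm0 nuP) ltW.
have cc : (c%:C)%C != 0 by apply/eqP; case; lra.
have nc : normc (c%:C)%C^-1 = c^-1 by rewrite normcV normc_real gtr0_norm.
exists ((c%:C)%C^-1 *: (x1 - x2)); split.
  rewrite (_ : _ - _ = (c%:C)%C^-1 *: ((x0 + (c%:C)%C *: x - x1) - (x0 - x2))); last first.
    rewrite (_ : _ - (x0 - x2) = (c%:C)%C *: x - (x1 - x2)); last by ring.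
    by rewrite [RHS]scalerBr scalerA mulVf // scale1r.
  rewrite (bnormZ nuP) nc mulrC ler_pdivrMr // mulrC.
  by apply: le_trans (bnormB nuP _ _) _; lra.
rewrite linearZ linearB /= (bnormZ nuP) nc.
have -> : 2 * K / r * nu x = c^-1 * (2 * K) by rewrite /c invf_div; ring.
rewrite ler_pM2l ?invr_gt0 //.
by apply: le_trans (bnormB nuP _ _) _; lra.
Qed.

Lemma closed_graph : exists M : R, 0 <= M /\ forall x, nu (D x) <= M * nu x.
Proof.
have [K [K0 KP]] := approx_bounded.
have /choice[G GP] : forall nx : nat * C, exists x', nu (nx.2 - x') <= 2^-1 ^+ nx.1 /\
    nu (D x') <= K * nu nx.2.
  by move=> [n x]; apply: KP; rewrite exprn_gt0 ?invr_gt0.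
have unit_ball x : nu x <= 1 -> nu (D x) <= 2 * K.
  move=> x1; pose y := fix y n := if n is m.+1 then y m - G (m.+1, y m) else x.
  pose x' n := G (n.+1, y n).
  have yP n : nu (y n) <= 2^-1 ^+ n.
    by case: n => [|n]; [rewrite expr0|have [] := GP (n.+1, y n)].
  have yE n : y n = x - \sum_(i < n) x' i.
    elim: n => [|n IH]; first by rewrite big_ord0 subr0.
    by rewrite big_ord_recr /= opprD addrA -IH.
  have x'P n : nu (D (x' n)) <= K * 2^-1 ^+ n.
    have [_] := GP (n.+1, y n); move/le_trans; apply.
    by rewrite ler_wpM2l // yP.
  have [t tP] := bnorm_series nuP x'P.
  suff -> : D x = t by have := tP 0; rewrite big_ord0 subr0 expr0 mulr1.
  (* The remainders [y n] tend to 0 while [D (y n)] tends to [D x - t], so [D x - t] is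
     separating. *)
  apply/subr0_eq/sep0 => e e0.
  have [n nP] := half_exp_small (1 + 2 * K) e0.
  have h0 : 0 <= 2^-1 ^+ n :> R by rewrite exprn_ge0 ?invr_ge0.
  have h1 := mulr_ge0 K0 h0.
  exists (y n); split; first by apply: le_trans (yP n) _; lra.
  rewrite yE linearB raddf_sum /=.
  rewrite (_ : _ - (D x - t) = t - \sum_(i < n) D (x' i)); last by ring.
  by apply: le_trans (tP n) _; lra.
exists (2 * K); split; first by rewrite mulr_ge0.
move=> x; have [x00|/eqP nx0] := eqVneq (nu x) 0.
  by rewrite (bnorm_eq0 nuP x00) linear0 bnorm0 // mulr0.
have nx : 0 < nu x by rewrite lt_neqAle (bnorm_ge0 nuP) andbT eq_sym; apply/eqP.
have := unit_ball (((nu x)^-1)%:C%C *: x).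
rewrite linearZ /= !(bnormZ nuP) normc_real gtr0_norm ?invr_gt0 //.
rewrite mulVf ?gt_eqF // => /(_ (lexx _)).
by rewrite mulrC ler_pdivrMr.
Qed.

End ClosedGraph.

Section Johnson.
Variables (R : realType) (C : comAlgType R[i]) (nu : C -> R).
Hypothesis nuP : banach_norm nu.
Hypothesis semisimple : forall x : C, (forall y, invertible (1 - y * x)) -> x = 0.
Variable D : {linear C -> C}.
Hypothesis DM : forall x y, D (x * y) = D x * y + x * D y.
Implicit Types (x y z u v w a : C).

Lemma derivation_const (k : R[i]) : D (k *: 1) = 0.
Proof.
have := DM 1 1; rewrite !mulr1 mul1r => /eqP; rewrite -subr_eq0 opprD addNKr oppr_eq0.
by move=> /eqP D1; rewrite linearZ /= D1 scaler0.
Qed.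

Lemma derivation_poly y (p : {poly R[i]}) :
  D (horner_alg y p) = horner_alg y p^`() * D y.
Proof.
elim/poly_ind: p => [|p c IH]; first by rewrite deriv0 !rmorph0 linear0 mul0r.
rewrite derivD derivC addr0 derivM derivX mulr1 !rmorphD !rmorphM /=.
rewrite !horner_algX horner_algC linearD /= derivation_const addr0 DM IH.
by rewrite mulrDl; ring.
Qed.

Lemma derivation_separating y : separating nu D y -> D y = 0.
Proof.
move=> ysep.
(* The value 0 is left out because the gliding hump requires nonzero [lam n]. *)
pose spec := [set l : R[i] | l != 0 /\ ~ invertible (y - l *: 1)]%classic.
have /finite_seqP[s specE] : finite_set spec.
  pose U : pointedType := HB.pack_for pointedType R[i] (isPointed.Build R[i] 0).
  apply: contrapT => /infiniteP /(@pcard_leP _ U) /injfunPex[/= f ff finj].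
  apply: (separating_not_infinite_spectrum nuP DM ysep (lam := f)).
  - by move=> m n /finj; apply; rewrite inE.
  - by move=> n; have [] := ff n Logic.I.
  - by move=> n; have [] := ff n Logic.I.
have inv_spec l : l \notin undup (0 :: s) -> invertible (y - l *: 1).
  rewrite mem_undup inE negb_or => /andP[l0 ls]; apply: contrapT => Ninv.
  have : spec l by [].
  by rewrite specE /=; exact/negP.
pose p := \prod_(l <- undup (0 :: s)) ('X - l%:P).
have p0 : p.[0] = 0.
  apply/eqP; rewrite -/(root p 0) root_prod_XsubC mem_undup inE eqxx //.
have py0 : horner_alg y p = 0.
  apply/semisimple/(entire_resolvent_radical nuP) => mu.
  have [->|mu0] := eqVneq mu 0; first by rewrite scale0r subr0; exists 1; rewrite mulr1.
  (* As 0 is a root of [p], [q] takes the value 1 at 0 and is nonzero. A root of [q] is not a root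
     of [p], hence lies off the spectrum, so all linear factors of [q] are invertible at [y]. *)
  pose q := 1 - mu *: p.
  have -> : 1 - mu *: horner_alg y p = horner_alg y q.
    by rewrite /q rmorphB rmorph1; rewrite -mul_polyC rmorphM /= horner_algC -scalerAl mul1r.
  have q0 : lead_coef q != 0.
    rewrite lead_coef_eq0; apply: contraTneq (oner_neq0 R[i]) => qE.
    have := congr1 (fun q => q.[0]) qE.
    by rewrite /q hornerD hornerN hornerZ p0 mulr0 subr0 hornerC horner0 => ->; rewrite eqxx.
  have [r rE] := closed_field_poly_normal q; rewrite rE -mul_polyC rmorphM /= horner_algC rmorph_prod /=.
  apply: invertibleM.
    by exists ((lead_coef q)^-1 *: 1); rewrite -scalerAl mul1r scalerA divff // scale1r.
  apply: invertible_prod => l lr; rewrite rmorphB /= horner_algX horner_algC.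
  apply: inv_spec; apply/negP => ls.
  have : root q l by rewrite rE rootZ // root_prod_XsubC.
  have : root p l by rewrite root_prod_XsubC.
  move=> /eqP pl; rewrite /root /q hornerD hornerN hornerZ pl mulr0 subr0 hornerC.
  by rewrite oner_eq0.
(* A Bezout relation between [p] and its derivative, evaluated at [y], makes [p'(y)] invertible,
   while [p'(y) * D y = D (p(y)) = 0]. *)
have : separable_poly p by rewrite separable_prod_XsubC undup_uniq.
rewrite separable_poly.unlock => /Bezout_eq1_coprimepP[[u v] /= uv].
have := congr1 (horner_alg y) uv.
rewrite rmorphD !rmorphM rmorph1 /= py0 mulr0 add0r => vp.
by rewrite -[D y]mul1r -vp -mulrA -derivation_poly py0 linear0 mulr0.
Qed.

Lemma separatingMl x y : separating nu D y -> separating nu D (x * y).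
Proof.
move=> ysep e e0; pose s := nu x + nu (D x) + 1.
have nx := bnorm_ge0 nuP x; have nDx := bnorm_ge0 nuP (D x).
have s0 : 0 < s by rewrite /s; lra.
have e'0 : 0 < e / s by rewrite divr_gt0.
have es : e / s * s = e by rewrite mulfVK // gt_eqF.
have [z [z1 z2]] := ysep _ e'0; exists (x * z).
have h1 := bnorm_leM nuP (lexx (nu x)) z1.
have h2 := bnorm_leM nuP (lexx (nu x)) z2.
have h3 := bnorm_leM nuP (lexx (nu (D x))) z1.
move: es; rewrite /s => es; split; first by nra.
rewrite DM (_ : _ - _ = x * (D z - y) + D x * z); last by ring.
by apply: le_trans (bnormD nuP _ _) _; nra.
Qed.

Lemma separating_eq0 y : separating nu D y -> y = 0.
Proof.
move=> ysep; have yD x : y * D x = 0.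
  have := derivation_separating (separatingMl x ysep).
  by rewrite DM (derivation_separating ysep) mulr0 addr0 mulrC.
have yy : y * y = 0.
  apply: (bnorm_eq0_small nuP (K := nu y)) => n.
  have [|x [_ xP]] := ysep (2^-1 ^+ n); first by rewrite exprn_gt0 ?invr_gt0.
  rewrite (_ : y * y = y * (y - D x)); last by rewrite mulrBr yD subr0.
  by apply: (bnorm_leM nuP) => //; rewrite bnormBC.
apply: semisimple => b; exists (1 + b * y).
by transitivity (1 - b * b * (y * y)); [ring|rewrite yy mulr0 subr0].
Qed.

(** * The Kleinecke-Shirokov argument *)

Section KleineckeShirokov.
Variable a : C.

(** The [j]-fold commutator of the operator [T] with multiplication by [a]. *)
Fixpoint iter_comm j (T : C -> C) x :=
  if j is i.+1 then iter_comm i T (a * x) - a * iter_comm i T x else T x.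

(** The commutator of [D] with multiplication by [a] is multiplication by [D a], which commutes with
    [a], so the Leibniz rule has only two terms. At [j = 0] the junk index [j.-1] has coefficient
    0. *)
Lemma iter_comm_derivation j (T : C -> C) x :
  iter_comm j (D \o T) x =
  D (iter_comm j T x) + j%:R * (D a * iter_comm j.-1 T x).
Proof.
elim: j x => [|j IH] x /=; first by rewrite mul0r addr0.
rewrite !IH linearB /= DM; case: j {IH} => [|j] /=; first by ring.
rewrite -[j.+2]addn1 natrD; ring.
Qed.

Lemma iter_comm_iter n x :
  iter_comm n (fun z => iter n D z) x = n`!%:R * (D a ^+ n * x) /\
  iter_comm n.+1 (fun z => iter n D z) x = 0.
Proof.
elim: n x => [|n IH] x; first by rewrite /= mul1r expr0 mul1r subrr.
have zero y : iter_comm n.+1 (fun z => iter n D z) y = 0 by have [] := IH y.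
split.
  rewrite (iter_comm_derivation n.+1 (fun z => iter n D z)) zero linear0 add0r.
  by have [-> _] := IH x; rewrite factS natrM exprS; ring.
rewrite (iter_comm_derivation n.+2 (fun z => iter n D z)) /= -/(iter_comm n.+1 _ _).
have [_ /= zx] := IH x; have [_ /= zax] := IH (a * x).
by rewrite zx zax !mulr0 subrr linear0 addr0.
Qed.

Lemma bnorm_iter_comm (T : C -> C) K : (forall x, nu (T x) <= K * nu x) ->
  forall j x, nu (iter_comm j T x) <= (2 * nu a) ^+ j * K * nu x.
Proof.
move=> TK; elim=> [|j IH] x; first by rewrite expr0 mul1r.
rewrite /=; apply: le_trans (bnormB nuP _ _) _.
have h1 := bnorm_leM nuP (lexx (nu a)) (IH x).
have h2 : nu (iter_comm j T (a * x)) <= nu a * ((2 * nu a) ^+ j * K * nu x).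
  apply: le_trans (IH _) _; have [K0|K0] := leP 0 K.
    rewrite mulrCA ler_wpM2l ?(bnormM nuP) // mulr_ge0 // exprn_ge0 // mulr_ge0 //.
    exact: bnorm_ge0.
  have z u : nu u = 0.
    have := TK u; have := bnorm_ge0 nuP u; have := bnorm_ge0 nuP (T u); nra.
  by rewrite !z !mulr0.
by rewrite exprS; lra.
Qed.

End KleineckeShirokov.

Theorem semisimple_derivation_eq0 a : D a = 0.
Proof.
have [M [M0 DMb]] := closed_graph nuP separating_eq0.
have iterM n x : nu (iter n D x) <= M ^+ n * nu x.
  elim: n => [|n IH]; first by rewrite expr0 mul1r.
  apply: le_trans (DMb _) _; rewrite exprS -mulrA.
  by rewrite ler_wpM2l.
apply: semisimple => b.
have power n : n`!%:R * nu (D a ^+ n) <= (2 * nu a * M) ^+ n * nu 1.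
  have [E _] := iter_comm_iter a n 1.
  have := bnorm_iter_comm a (iterM n) n 1; rewrite E mulr1.
  rewrite mulr_natl -scaler_nat (bnormZ nuP) [(2 * nu a * M) ^+ n]exprMn.
  by rewrite -(rmorph_nat (real_complex R)) normc_real ger0_norm.
have := @cvg_exp_coeff R (nu b * (2 * nu a * M)).
(* This threshold, multiplied by [nu 1], stays below 1/2, so a power of [b * D a] has norm at most
   1/2. *)
have e0 : 0 < (2 * (nu 1 + 1))^-1.
  by rewrite invr_gt0 mulr_gt0 // ltr_wpDl // bnorm_ge0.
move=> /cvgrPdist_le /(_ _ e0) [N _ /(_ N.+1 (leqnSn N))] /=.
rewrite sub0r normrN ger0_norm /exp_coeff /=; last first.
  by rewrite divr_ge0 // exprn_ge0 // !mulr_ge0 // bnorm_ge0.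
rewrite ler_pdivrMr ?ltr0n ?fact_gt0 // => small.
apply: (@invertible_subX _ _ N.+1); apply: (invertible_sub1 nuP).
rewrite exprMn; have f0 : 0 < N.+1`!%:R :> R by rewrite ltr0n fact_gt0.
rewrite -(ler_pM2l f0).
have nb : 0 <= nu b ^+ N.+1 by rewrite exprn_ge0 // bnorm_ge0.
apply: (@le_trans _ _ (N.+1`!%:R * (nu b ^+ N.+1 * nu (D a ^+ N.+1)))).
  by rewrite ler_pM2l // (bnorm_leM nuP) // (bnormX nuP).
rewrite mulrCA; apply: (@le_trans _ _ (nu b ^+ N.+1 * ((2 * nu a * M) ^+ N.+1 * nu 1))).
  by rewrite ler_wpM2l.
rewrite mulrA -exprMn.
have n1 := bnorm_ge0 nuP 1.
apply: le_trans (ler_wpM2r n1 small) _.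
rewrite mulrAC mulrC ler_pM2l // ler_pdivrMl ?mulr_gt0 //; lra.
Qed.

End Johnson.

(** * The corner of a right identity *)

Lemma addxx_inj (F : numFieldType) (V : lmodType F) (x y : V) :
  x + x = y + y -> x = y.
Proof.
have dbl (u : V) : u + u = (1 + 1) *: u by rewrite scalerDl scale1r.
by rewrite !dbl; apply: scalerI; exact: lt0r_neq0 (addr_gt0 ltr01 ltr01).
Qed.

Section RealNorm.
Variables (R : realType) (A : completeNormedModType R[i]).
Implicit Types a b : A.

(** The norm of [A] takes values in [R[i]]; they are real, so the real part carries all of it. *)
Definition rnorm a : R := complex.Re `|a|.

Lemma rnormE a : `|a| = ((rnorm a)%:C)%C.
Proof. by rewrite /rnorm RRe_real // normr_real. Qed.

Lemma rnorm_le a (e : R) : (`|a| <= (e%:C)%C) = (rnorm a <= e).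
Proof. by rewrite rnormE lecR. Qed.

Lemma rnorm_ge0 a : 0 <= rnorm a.
Proof. by rewrite -lecR -rnormE normr_ge0. Qed.

Lemma rnormD a b : rnorm (a + b) <= rnorm a + rnorm b.
Proof. by rewrite -rnorm_le rmorphD /= -!rnormE ler_normD. Qed.

Lemma rnormN a : rnorm (- a) = rnorm a.
Proof. by rewrite /rnorm normrN. Qed.

Lemma rnormZ (k : R[i]) a : rnorm (k *: a) = normc k * rnorm a.
Proof.
by apply: complexI; rewrite rmorphM /= -!rnormE normrZ; case: k.
Qed.

Lemma rnorm_eq0 a : rnorm a = 0 -> a = 0.
Proof. by move=> a0; apply/eqP; rewrite -normr_eq0 rnormE a0. Qed.

Lemma rnorm_complete (x : nat -> A) : (forall n, rnorm (x n) <= 2^-1 ^+ n) ->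
  exists s, forall n, rnorm (s - \sum_(i < n) x i) <= 2 * 2^-1 ^+ n.
Proof.
move=> xP; pose S n := \sum_(i < n) x i.
have dist n k : rnorm (S (n + k)%N - S n) <= 2 * 2^-1 ^+ n - 2 * 2^-1 ^+ (n + k)%N.
  elim: k => [|k IH]; first by rewrite addn0 !subrr /rnorm normr0.
  rewrite addnS {1}/S big_ord_recr /= -/(S _) addrAC.
  apply: le_trans (rnormD _ _) _; have := xP (n + k)%N; rewrite exprSr; lra.
have distS n m : (n <= m)%N -> rnorm (S m - S n) <= 2 * 2^-1 ^+ n.
  move=> nm; rewrite -(subnKC nm); apply: le_trans (dist _ _) _.
  by rewrite gerBl mulr_ge0 // exprn_ge0 ?invr_ge0.
have : cvg (S @ \oo)%classic.
  apply/cauchy_cvgP/cauchy_exP => eps eps0.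
  have epsE : eps = ((complex.Re eps)%:C)%C by rewrite RRe_real // gtr0_real.
  have e0 : 0 < complex.Re eps by rewrite -ltcR -epsE.
  have [n nP] := half_exp_small 2 (divr_gt0 e0 (ltr0n _ 2)).
  exists (S n); exists n => // m /= nm.
  rewrite -ball_normE /= distrC rnormE epsE ltcR.
  by apply: le_lt_trans (distS _ _ nm) _; lra.
move=> /cvg_ex[s sP]; exists s => n; apply/ler_addgt0Pr => e e0.
have ec0 : 0 < (e%:C)%C :> R[i] by rewrite ltcR.
have [m _ mP] := (iffLR (cvgrPdist_le _ _)) sP _ ec0.
have /= := mP (maxn m n) (leq_maxl _ _); rewrite rnorm_le => h1.
have h2 := distS n (maxn m n) (leq_maxr _ _).
rewrite -/(S n) -(subrK (S (maxn m n)) s) -addrA.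
by apply: le_trans (rnormD _ _) _; rewrite [leRHS]addrC lerD.
Qed.

End RealNorm.

(* The hypotheses are packed in a record so that the corner [eA] gets its
   canonical ring structure from the parameters of its type. *)
Record corner_data (R : realType) (A : completeNormedModType R[i]) := CornerData {
  cmul : A -> A -> A;
  cunit : A;
  cmulP : banach_algebra_mul cmul;
  cmulr1 : forall a, cmul a cunit = a;
  cmulAC : forall x a b, cmul x (cmul a b) = cmul x (cmul b a);
  cunit_neq0 : cunit != 0 }.

Section Corner.
Variables (R : realType) (A : completeNormedModType R[i]) (S : corner_data A).
Local Notation "a ** b" := (cmul S a b) (at level 40, left associativity).
Local Notation e := (cunit S).

Lemma cmulA a b c : a ** b ** c = a ** (b ** c).
Proof. by have [H _] := cmulP S; exact: H. Qed.
Lemma cmulDl a b c : (a + b) ** c = a ** c + b ** c.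
Proof. by have [_ [H _ _ _ _]] := cmulP S; exact: H. Qed.
Lemma cmulDr a b c : a ** (b + c) = a ** b + a ** c.
Proof. by have [_ [_ H _ _ _]] := cmulP S; exact: H. Qed.
Lemma cmulZl k a b : (k *: a) ** b = k *: (a ** b).
Proof. by have [_ [_ _ H _ _]] := cmulP S; exact: H. Qed.
Lemma cmulZr k a b : a ** (k *: b) = k *: (a ** b).
Proof. by have [_ [_ _ _ H _]] := cmulP S; exact: H. Qed.
Lemma cmulNl a b : (- a) ** b = - (a ** b).
Proof. by rewrite -scaleN1r cmulZl scaleN1r. Qed.
Lemma cmulNr a b : a ** (- b) = - (a ** b).
Proof. by rewrite -scaleN1r cmulZr scaleN1r. Qed.
Lemma cmul0r a : a ** 0 = 0.
Proof. by have := cmulZr 0 a 0; rewrite !scale0r. Qed.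

Lemma rnorm_cmul a b : rnorm (a ** b) <= rnorm a * rnorm b.
Proof.
have [_ [_ _ _ _ mulN]] := cmulP S.
by rewrite -rnorm_le rmorphM /= -!rnormE.
Qed.

(** As [e] is idempotent, [eA] is the set of fixed points of left multiplication by [e]. *)
Definition corner := {x : A | e ** x == x}.
HB.instance Definition _ := Choice.on corner.

Fact corner_proj_subproof a : e ** (e ** a) == e ** a.
Proof. by rewrite -cmulA cmulr1. Qed.
Definition corner_proj a : corner :=
  exist (fun x : A => e ** x == x) (e ** a) (corner_proj_subproof a).

Lemma cornerP (x : corner) : e ** sval x = sval x.
Proof. by apply/eqP; exact: (svalP x). Qed.

Lemma corner_inj (x y : corner) : sval x = sval y -> x = y.
Proof. exact: val_inj. Qed.

(** Results are projected back into [eA], which avoids closure proofs; the [sval] lemmas below show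
    that the projection changes nothing. *)
Definition cornerD (x y : corner) := corner_proj (sval x + sval y).
Definition cornerN (x : corner) := corner_proj (- sval x).
Definition cornerM (x y : corner) := corner_proj (sval x ** sval y).
Definition cornerZ (k : R[i]) (x : corner) := corner_proj (k *: sval x).
Definition corner1 := corner_proj e.

Lemma sval_cornerD x y : sval (cornerD x y) = sval x + sval y.
Proof. by rewrite /= cmulDr !cornerP. Qed.
Lemma sval_cornerN x : sval (cornerN x) = - sval x.
Proof. by rewrite /= cmulNr cornerP. Qed.
Lemma sval_cornerM x y : sval (cornerM x y) = sval x ** sval y.
Proof. by rewrite /= -cmulA cornerP. Qed.
Lemma sval_cornerZ k x : sval (cornerZ k x) = k *: sval x.
Proof. by rewrite /= cmulZr cornerP. Qed.
Lemma sval_corner1 : sval corner1 = e.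
Proof. exact: cmulr1. Qed.

Let svalE := (sval_cornerD, sval_cornerN, sval_cornerM, sval_cornerZ, sval_corner1).

Fact cornerDA : associative cornerD.
Proof. by move=> x y z; apply: corner_inj; rewrite !svalE addrA. Qed.
Fact cornerDC : commutative cornerD.
Proof. by move=> x y; apply: corner_inj; rewrite !svalE addrC. Qed.
Fact corner0D : left_id (corner_proj 0) cornerD.
Proof. by move=> x; apply: corner_inj; rewrite !svalE /= cmul0r add0r. Qed.
Fact cornerND : left_inverse (corner_proj 0) cornerN cornerD.
Proof. by move=> x; apply: corner_inj; rewrite !svalE /= cmul0r addNr. Qed.

HB.instance Definition _ := GRing.isZmodule.Build corner
  cornerDA cornerDC corner0D cornerND.

Fact cornerMA : associative cornerM.
Proof. by move=> x y z; apply: corner_inj; rewrite !svalE cmulA. Qed.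
Fact cornerMC : commutative cornerM.
Proof. by move=> x y; apply: corner_inj; rewrite /= cmulAC. Qed.
Fact corner1M : left_id corner1 cornerM.
Proof. by move=> x; apply: corner_inj; rewrite !svalE cornerP. Qed.
Fact cornerMDl : left_distributive cornerM +%R.
Proof. by move=> x y z; apply: corner_inj; rewrite !svalE cmulDl. Qed.
Fact corner1_neq0 : corner1 != 0.
Proof.
apply/eqP => /(congr1 sval); rewrite sval_corner1 /= cmul0r.
exact/eqP/cunit_neq0.
Qed.

HB.instance Definition _ := GRing.Zmodule_isComNzRing.Build corner
  cornerMA cornerMC corner1M cornerMDl corner1_neq0.

Fact cornerZA k l x : cornerZ k (cornerZ l x) = cornerZ (k * l) x.
Proof. by apply: corner_inj; rewrite !svalE scalerA. Qed.
Fact corner1Z : left_id 1 cornerZ.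
Proof. by move=> x; apply: corner_inj; rewrite !svalE scale1r. Qed.
Fact cornerZDr : right_distributive cornerZ +%R.
Proof. by move=> k x y; apply: corner_inj; rewrite !svalE scalerDr. Qed.
Fact cornerZDl x : {morph cornerZ^~ x : k l / k + l}.
Proof. by move=> k l; apply: corner_inj; rewrite !svalE scalerDl. Qed.

HB.instance Definition _ := GRing.Zmodule_isLmodule.Build R[i] corner
  cornerZA corner1Z cornerZDr cornerZDl.

Fact cornerZMl (k : R[i]) (x y : corner) : k *: (x * y) = k *: x * y.
Proof. by apply: corner_inj; rewrite !svalE cmulZl. Qed.

HB.instance Definition _ := GRing.Lmodule_isLalgebra.Build R[i] corner cornerZMl.
HB.instance Definition _ := GRing.Lalgebra_isComAlgebra.Build R[i] corner.

Lemma sval_corner_sum n (F : 'I_n -> corner) :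
  sval (\sum_i F i) = \sum_i sval (F i).
Proof.
elim/big_ind2 : _ => //; first by rewrite /= cmul0r.
by move=> _ x _ y <- <-; rewrite svalE.
Qed.

Definition corner_norm (x : corner) : R := rnorm (sval x).

Lemma corner_banach : banach_norm corner_norm.
Proof.
split.
- by move=> x y; rewrite /corner_norm svalE rnormD.
- by move=> k x; rewrite /corner_norm svalE rnormZ.
- by move=> x y; rewrite /corner_norm svalE rnorm_cmul.
- by move=> x /rnorm_eq0 x0; apply: corner_inj; rewrite x0 /= cmul0r.
- move=> x /rnorm_complete[s sP].
  (* The corner is closed: [e ** s - s] equals [e ** t - t] for each remainder [t], hence is
     arbitrarily small. *)
  have es : e ** s = s.
    apply/subr0_eq/rnorm_eq0/eqP; rewrite eq_le rnorm_ge0 andbT leNgt; apply/negP => h.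
    have [|n] := @half_exp_small R ((rnorm e + 1) * 2) (rnorm (e ** s - s) / 2).
      by rewrite divr_gt0.
    set t := s - \sum_(i < n) sval (x i).
    have eE : e ** s - s = e ** t - t.
      rewrite /t cmulDr cmulNr -sval_corner_sum cornerP.
      by rewrite opprB addrA subrK.
    rewrite -mulrA; have := sP n; rewrite -/t; have := rnormD (e ** t) (- t).
    rewrite -eE rnormN; have := rnorm_cmul e t; have := rnorm_ge0 e.
    set p := 2 * _; nra.
  exists (corner_proj s) => n.
  have -> : corner_norm (corner_proj s - \sum_(i < n) x i) =
      rnorm (s - \sum_(i < n) sval (x i)).
    by rewrite /corner_norm !svalE /= es sval_corner_sum.
  exact: sP.
Qed.

Hypothesis radP : forall x, in_rad (cmul S) x <-> in_rann (cmul S) x.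

(** If [v] inverts [1 - (e b) x] in the corner, then [- (b x) v] is a quasi-inverse of [b x] in [A].
    So [x] lies in the radical, which is the right annihilator, and [x = e x = 0]. *)
Lemma corner_semisimple (x : corner) : (forall y, invertible (1 - y * x)) -> x = 0.
Proof.
move=> xinv; suff /radP/(_ e) ex : in_rad (cmul S) (sval x).
  by apply: corner_inj; rewrite /= cmul0r -ex cornerP.
move=> b; have [v vP] := xinv (corner_proj b).
have {}vP : sval v = e + (e ** b) ** (sval x ** sval v).
  have := congr1 sval vP; rewrite !svalE => /eqP.
  by rewrite cmulDl cmulNl cornerP subr_eq /= -cmulA => /eqP.
set u := b ** sval x.
have uu : u ** sval v = u + u ** (u ** sval v).
  rewrite {1}vP cmulDr cmulr1; congr (_ + _).
  by rewrite (cmulA e) -(cmulA u e) cmulr1 /u !cmulA.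
have cancel : u - u ** sval v + u ** (u ** sval v) = 0.
  by rewrite {1}uu opprD addrA subrr add0r addNr.
exists (- (u ** sval v)); rewrite cmulNl cmulNr !opprK (cmulA u) (cmulAC S u (sval v)).
by split.
Qed.

(** The compression of [d] by [e] is a derivation of the corner, because [y e = y] and [e y = y]
    there. *)
Lemma corner_derivation_eq0 (d : A -> A) : derivation (cmul S) d ->
  forall x, e ** x = x -> e ** d x = 0.
Proof.
move=> [[dD dZ] dM] x ex.
pose f (y : corner) : corner := corner_proj (d (sval y)).
have fE y : sval (f y) = e ** d (sval y) by [].
have flin : linear f.
  move=> k y z; apply: corner_inj.
  by rewrite !svalE !fE !svalE dD dZ cmulDr cmulZr.
pose D : {linear corner -> corner} :=
  HB.pack f (GRing.isLinear.Build R[i] corner corner *:%R f flin).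
have fM y z : D (y * z) = D y * z + y * D z.
  apply: corner_inj; rewrite !svalE !fE !svalE dM cmulDr -cmulA; congr (_ + _).
  by rewrite -!cmulA cornerP cmulr1.
have := semisimple_derivation_eq0 corner_banach corner_semisimple fM (corner_proj x).
by move=> /(congr1 sval); rewrite /= ex cmul0r.
Qed.

(** * Generalized derivations of [A] *)

Variables (delta d : A -> A) (k : nat).
Hypothesis dP : generalized_derivation (cmul S) delta d.
Hypothesis k_gt0 : (0 < k)%N.

(** Split [x] into [e x], handled in the corner, and [n = x - e x] in the right annihilator.
    Differentiating [e n = 0] gives [e (d n) = 0], since [(d e) n = 0]. *)
Lemma derivation_rann a x : a ** d x = 0.
Proof.
have [dder _] := dP; have [[dD dZ] dM] := dder.
suff ed : e ** d x = 0 by rewrite -(cmulr1 S a) cmulA ed cmul0r.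
have en : e ** (x - e ** x) = 0 by rewrite cmulDr cmulNr -cmulA cmulr1 subrr.
have nrann b : b ** (x - e ** x) = 0 by rewrite -(cmulr1 S b) cmulA en cmul0r.
have d0 : d 0 = 0 by have := dZ 0 0; rewrite !scale0r.
have dn : e ** d (x - e ** x) = 0.
  by have := dM e (x - e ** x); rewrite !nrann d0 add0r.
rewrite -(subrK (e ** x) x) dD cmulDr dn add0r.
by apply: corner_derivation_eq0 => //; rewrite -cmulA cmulr1.
Qed.

Lemma apow_idem x : x ** x = x -> apow (cmul S) x k = x.
Proof.
case: k k_gt0 => // n _ xx; elim: n => [|[|n] IH] //=.
by rewrite /= in IH; rewrite IH.
Qed.

Lemma generalized_derivationE a : delta a = a ** delta e + d a.
Proof. by have [_ [_ /(_ a e)]] := dP; rewrite !cmulr1. Qed.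

Lemma skew_centralizing_mulr : k_skew_centralizing (cmul S) k delta ->
  [/\ in_center (cmul S) (delta e), delta e = e ** delta e
    & forall a, delta a = a ** delta e].
Proof.
move=> cent; have ee : e ** e = e by rewrite cmulr1.
have [[[dD dZ] dM] _] := dP.
have mul0 a : 0 ** a = 0.
  by have := cmulZl 0 0 a; rewrite !scale0r.
set z := delta e.
have s_cent a : a ** z + a ** z = (z + e ** z) ** a.
  have := cent e a; rewrite /anticomm apow_idem // -/z cmulr1 cmulDr.
  by rewrite -cmulA cmulr1.
have zE : z = e ** z.
  have := s_cent e; rewrite cmulr1 => /eqP.
  by rewrite eq_sym (inj_eq (addIr _)) => /eqP.
have z_cent : in_center (cmul S) z.
  by move=> a; apply: addxx_inj; rewrite s_cent -zE cmulDl.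
have de : d e = 0.
  by apply: (addrI (e ** z)); rewrite -generalized_derivationE addr0 -/z.
have d_corner a : d (e ** a) = 0 by rewrite dM de mul0 derivation_rann addr0.
have d_rann n : (forall a, a ** n = 0) -> d n = 0.
  move=> n_rann; have zn0 : n ** z = 0 by rewrite z_cent n_rann.
  (* Being idempotent, [e + n] equals its own [k]-th power, so the condition there does not depend
     on [k]. *)
  have idem : (e + n) ** (e + n) = e + n by rewrite cmulDr cmulr1 n_rann addr0.
  have dE : delta (e + n) = z + d n.
    by rewrite generalized_derivationE cmulDl zn0 addr0 -zE dD de add0r.
  (* The central element is [(z + d n) + z]; left multiplication by [e] kills [d n], right
     multiplication by [e] keeps it. *)
  have := cent (e + n) e; rewrite /anticomm apow_idem // dE.
  have -> : (z + d n) ** (e + n) = z + d n by rewrite cmulDr n_rann cmulr1 addr0.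
  have -> : (e + n) ** (z + d n) = z.
    by rewrite cmulDr derivation_rann addr0 cmulDl zn0 addr0 -zE.
  rewrite cmulr1 !cmulDr derivation_rann addr0 -zE -addrA => /addrI.
  by rewrite -{1}(add0r z) => /addIr.
split => // a; rewrite generalized_derivationE -/z.
rewrite -[in d a](subrK (e ** a) a) dD d_corner d_rann ?addr0 // => b.
by rewrite cmulDr cmulNr -cmulA cmulr1 subrr.
Qed.

Lemma skew_commuting_eq0 : k_skew_commuting (cmul S) k delta ->
  forall a, delta a = 0.
Proof.
move=> comm; have [|_ zE dE] := skew_centralizing_mulr.
  by move=> a b; rewrite comm cmul0r; have := cmulZl 0 0 b; rewrite !scale0r.
move=> a; have := comm e; rewrite /anticomm apow_idem ?cmulr1 // -zE.
rewrite -[X in _ = X](addr0 0) => /addxx_inj z0.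
by rewrite dE z0 cmul0r.
Qed.

End Corner.

Theorem theorem5p1 (R : realType) (A : completeNormedModType R[i])
  (mul : A -> A -> A) (delta d : A -> A) (k : nat) :
  banach_algebra_mul mul ->
  (forall x, in_rad mul x <-> in_rann mul x) ->
  quotient_rad_commutative mul ->
  has_right_identity mul ->
  generalized_derivation mul delta d ->
  (0 < k)%N ->
  (k_skew_centralizing mul k delta ->
     exists z, in_center mul z /\ forall a, delta a = mul a z) /\
  (k_skew_commuting mul k delta -> forall a, delta a = 0).
Proof.
move=> mulP radP quotC [e er] dP k0.
have [_ [_ mulDr _ mulZr _]] := mulP.
have mul0r a : mul a 0 = 0 by have := mulZr 0 a 0; rewrite !scale0r.
(* The corner has to be a nonzero ring; if [e = 0], then [A] itself is zero. *)
have [e0|e0] := eqVneq e 0.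
  have all0 (a : A) : a = 0 by rewrite -(er a) e0 mul0r.
  split; last by move=> _ a; exact: all0.
  by move=> _; exists 0; split => a; rewrite [LHS]all0 [RHS]all0.
(* Commutators lie in the radical, hence in the right annihilator. *)
have mulAC x a b : mul x (mul a b) = mul x (mul b a).
  have /radP/(_ x) := quotC a b.
  by rewrite mulDr -scaleN1r mulZr scaleN1r => /subr0_eq.
pose S := CornerData mulP er mulAC e0.
split=> [cent|comm]; last exact: (skew_commuting_eq0 (S := S) radP dP k0 comm).
have [zc _ zE] := skew_centralizing_mulr (S := S) radP dP k0 cent.
by exists (delta e).
Qed.
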